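(* Let $m\in(0,\infty)$, $\lambda_L,\lambda_R\in[0,1)$, and $\rho_\alpha=\lambda_\alpha/(1-\lambda_\alpha)$ for $\alpha\in\{L,R\}$. (i) If the boundary rates are, for $\alpha\in\{L,R\}$ and $n\in\mathbb N$, $$d_\alpha(n)=\frac{n}{1-\lambda_\alpha},\qquad b_\alpha(n)=\Big(\frac m2+n\Big)\frac{\lambda_\alpha}{1-\lambda_\alpha},$$ then they satisfy the detailed balance condition $$b_\alpha(k)\,\nu^m_{\lambda_\alpha}(k)=d_\alpha(k+1)\,\nu^m_{\lambda_\alpha}(k+1),\qquad k\in\mathbb N,$$ and the boundary driven SIP$(m)$ generator $\mathcal L$ is dual to the generator $\hat{\mathcal L}$ with absorbing boundaries: for all $\xi\in\mathbb N^{\{0,\dots,N+1\}}$ and $\eta\in\mathbb N^{\{1,\dots,N\}}$, $$\big(\mathcal L\,\mathcal D(\xi,\cdot)\big)(\eta)=\big(\hat{\mathcal L}\,\mathcal D(\cdot,\eta)\big)(\xi).$$ (ii) Conversely, let $\lambda_\alpha\in(0,1)$ for $\alpha\in\{L,R\}$. If rates $b_\alpha,d_\alpha$ satisfy the detailed balance condition in (i) together with the boundary duality relations $$b_\alpha(n)\big(D(k,n+1)-D(k,n)\big)+d_\alpha(n)\big(D(k,n-1)-D(k,n)\big)=k\big(D(k-1,n)\rho_\alpha-D(k,n)\big)\quad\text{for all }k\le n,$$ then $b_\alpha$ and $d_\alpha$ are the rates given in (i).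
   Context: The boundary driven SIP$(m)$ on the chain $\{1,\dots,N\}$ is the Markov process on $\mathbb N^{\{1,\dots,N\}}$ ($\mathbb N=\{0,1,2,\dots\}$) with generator $\mathcal L=\mathcal L_1+\mathcal L_N+\mathcal L_{bulk}$, where $$\mathcal L_{bulk}f(\eta)=\sum_{x=1}^{N-1}\Big[2\eta_x(m+2\eta_{x+1})\big(f(\eta^{x,x+1})-f(\eta)\big)+2\eta_{x+1}(m+2\eta_x)\big(f(\eta^{x+1,x})-f(\eta)\big)\Big],$$ $$\mathcal L_1f(\eta)=d_L(\eta_1)(f(\eta-\delta_1)-f(\eta))+b_L(\eta_1)(f(\eta+\delta_1)-f(\eta)),$$ $$\mathcal L_Nf(\eta)=d_R(\eta_N)(f(\eta-\delta_N)-f(\eta))+b_R(\eta_N)(f(\eta+\delta_N)-f(\eta)),$$ with $\eta^{x,y}$ obtained from $\eta$ by moving one particle from $x$ to $y$, and death rates satisfying $d_\alpha(0)=0$. The dual generator acts on functions of $\xi\in\mathbb N^{\{0,\dots,N+1\}}$: $\hat{\mathcal L}=\mathcal L_{bulk}+\hat{\mathcal L}_1+\hat{\mathcal L}_N$, with $\mathcal L_{bulk}$ acting on the coordinates $1,\dots,N$, and $$\hat{\mathcal L}_1f(\xi)=\xi_1(f(\xi^{1,0})-f(\xi)),\qquad\hat{\mathcal L}_Nf(\xi)=\xi_N(f(\xi^{N,N+1})-f(\xi)).$$ Duality functions: $D(k,n)=\frac{n!}{(n-k)!}\frac{\Gamma(m/2)}{\Gamma(m/2+k)}$ for $k\le n$,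 $D(k,n)=0$ for $k>n$, and $$\mathcal D(\xi,\eta)=\rho_L^{\xi_0}\Big(\prod_{x=1}^ND(\xi_x,\eta_x)\Big)\rho_R^{\xi_{N+1}}.$$ For $0\le\lambda<1$, $\nu^m_\lambda(n)=(1-\lambda)^{m/2}\frac{\lambda^n}{n!}\frac{\Gamma(m/2+n)}{\Gamma(m/2)}$, $n\in\mathbb N$. Terms multiplied by $d_\alpha(0)=0$ or by $k=0$ are read as zero. *)

(* Defs.v *)
From HB Require Import structures.
From mathcomp Require Import all_boot all_order all_algebra.
From mathcomp Require Import all_classical all_reals all_analysis.

Set Implicit Arguments.
Unset Strict Implicit.
Unset Printing Implicit Defensive.

Import Order.TTheory GRing.Theory Num.Theory.
Import numFieldNormedType.Exports.

Local Open Scope ring_scope.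

(* The chain {1, ..., N} with N = n.+1 >= 1 is indexed by 'I_n.+1 (the site x
   is the ordinal x - 1); the extended chain {0, ..., N+1} is 'I_n.+3. *)

Definition config (S : finType) := {ffun S -> nat}.

Inductive side := Lft | Rgt.

Definition Gamma (R : realType) (x : R) : R :=
  (\int[lebesgue_measure]_(t in `]0%R, +oo[%classic)
     (t `^ (x - 1) * expR (- t)))%R.

(* In the next two definitions subtraction on nat is truncated, so removing
   a particle from an empty site has no effect. In the generators such a term
   always carries the rate 0 (for remove, because d 0 = 0). *)
Definition jump (S : finType) (eta : config S) (x y : S) : config S :=
  [ffun z => (eta z - (z == x) + (z == y))%N].

Definition remove (S : finType) (eta : config S) (x : S) : config S :=
  [ffun z => (eta z - (z == x))%N].

Definition add (S : finType) (eta : config S) (x : S) : config S :=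
  [ffun z => (eta z + (z == x))%N].

(* The chain is embedded in the index set S by c, so that the same operator
   acts on functions of eta (S = 'I_n.+1) and of xi (S = 'I_n.+3). *)
Definition Lbulk (R : realType) (m : R) (n : nat) (S : finType)
    (c : 'I_n.+1 -> S) (f : config S -> R) (eta : config S) : R :=
  \sum_(i < n)
    (let x := c (widen_ord (leqnSn n) i) in
     let y := c (lift ord0 i) in
     2 * (eta x)%:R * (m + 2 * (eta y)%:R) * (f (jump eta x y) - f eta) +
     2 * (eta y)%:R * (m + 2 * (eta x)%:R) * (f (jump eta y x) - f eta)).

Definition Lbirthdeath (R : realType) (b d : nat -> R) (S : finType) (x : S)
    (f : config S -> R) (eta : config S) : R :=
  d (eta x) * (f (remove eta x) - f eta) +
  b (eta x) * (f (add eta x) - f eta).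

Definition Labsorb (R : realType) (S : finType) (x y : S)
    (f : config S -> R) (xi : config S) : R :=
  (xi x)%:R * (f (jump xi x y) - f xi).

Definition Lsip (R : realType) (m : R) (b d : side -> nat -> R) (n : nat)
    (f : config 'I_n.+1 -> R) (eta : config 'I_n.+1) : R :=
  Lbirthdeath (b Lft) (d Lft) ord0 f eta +
  Lbirthdeath (b Rgt) (d Rgt) ord_max f eta +
  Lbulk m id f eta.

Definition bulk_site (n : nat) (x : 'I_n.+1) : 'I_n.+3 :=
  lift ord0 (widen_ord (leqnSn n.+1) x).

Definition Ldual (R : realType) (m : R) (n : nat)
    (f : config 'I_n.+3 -> R) (xi : config 'I_n.+3) : R :=
  Lbulk m (@bulk_site n) f xi +
  Labsorb (bulk_site ord0) ord0 f xi +
  Labsorb (bulk_site ord_max) ord_max f xi.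

Definition dualD (R : realType) (m : R) (k n : nat) : R :=
  if (k <= n)%N then
    n`!%:R / (n - k)`!%:R * (Gamma (m / 2) / Gamma (m / 2 + k%:R))
  else 0.

Definition rho (R : realType) (lam : R) : R := lam / (1 - lam).

Definition dualFun (R : realType) (m : R) (lam : side -> R) (n : nat)
    (xi : config 'I_n.+3) (eta : config 'I_n.+1) : R :=
  rho (lam Lft) ^+ xi ord0 *
  (\prod_(x < n.+1) dualD m (xi (bulk_site x)) (eta x)) *
  rho (lam Rgt) ^+ xi ord_max.

Definition nu (R : realType) (m lam : R) (n : nat) : R :=
  (1 - lam) `^ (m / 2) * (lam ^+ n / n`!%:R) *
  (Gamma (m / 2 + n%:R) / Gamma (m / 2)).

Definition death_rate (R : realType) (lam : R) (n : nat) : R :=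
  n%:R / (1 - lam).

Definition birth_rate (R : realType) (m lam : R) (n : nat) : R :=
  (m / 2 + n%:R) * (lam / (1 - lam)).

Definition detailed_balance (R : realType) (m lam : R) (b d : nat -> R) : Prop :=
  forall k : nat, b k * nu m lam k = d k.+1 * nu m lam k.+1.

(* The predecessors are truncated: D(k, n-1) for n = 0 and D(k-1, n) for k = 0
   are only met with the coefficients d 0 = 0 and k = 0. *)
Definition boundary_duality (R : realType) (m lam : R) (b d : nat -> R) : Prop :=
  forall k n : nat, (k <= n)%N ->
    b n * (dualD m k n.+1 - dualD m k n) +
    d n * (dualD m k n.-1 - dualD m k n) =
    k%:R * (dualD m k.-1 n * rho lam - dualD m k n).

(* Main.v *)
Require Import Defs.
From HB Require Import structures.
From mathcomp Require Import all_boot all_order all_algebra.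
From mathcomp Require Import all_classical all_reals all_analysis.
From mathcomp Require Import measurable_realfun ring lra.

Import Order.TTheory GRing.Theory Num.Theory.
Import numFieldNormedType.Exports.

Local Open Scope ring_scope.

(** Up to the normalisation Gamma(m/2)/Gamma(m/2+k), D(k,n) is the falling
    factorial of n, so multiplication by n, removal and addition of a particle
    in the variable n are expressed through the shifts k-1, k, k+1 (an su(1,1)
    ladder).  Both sides of the duality relation on a bond or at a boundary site
    then become the same polynomial in these shifted functions, and the other
    sites enter the product only through a common factor.

    For the converse, the boundary relations with k = 1 and k = 2 are two linear
    equations that determine b(n) and d(n) for n >= 2; detailed balance then
    gives b(1) from d(2), the relation with k = 1 gives d(1), and detailed
    balance gives b(0).

    The only property of Gamma that enters is Gamma(x+1) = x Gamma(x) > 0. *)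

(** * The Gamma function *)

Section GammaFunction.
Local Open Scope classical_set_scope.

Local Notation mu := lebesgue_measure.

(** Turns [expR (- t)] into an integral over [s >= t] in [GintD1]; at [a = 0] it is the base case of
    [Gint_nat]. *)
Lemma integral_expRN_tail {R : realType} (a : R) :
  (\int[mu]_(s in `[a, +oo[) (expR (- s))%:E = (expR (- a))%:E)%E.
Proof.
have cN : continuous (fun s : R => expR (- s)).
  by move=> s; apply: continuous_comp; [exact: continuousN|exact: continuous_expR].
rewrite (@ge0_continuous_FTC2y _ _ (fun s => - expR (- s)) _ 0).
- by rewrite EFinN oppeK add0e.
- by move=> s _; exact: expR_ge0.
- by apply: continuous_subspaceT.
- by rewrite -oppr0; apply: cvgN; exact: cvgr_expR.
- by move=> s _; exact: ex_derive.
- by apply: cvg_at_right_filter; apply: cvgN; exact: cN.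
- move=> s _; rewrite derive1E.
  have [_ ->] : is_derive s 1 (fun s => - expR (- s)) (expR (- s)).
    by apply: is_derive_eq; rewrite mulrN1 opprK.
  by [].
Qed.

Lemma integral_powR_itv {R : realType} (x a b : R) : 0 < a -> a < b ->
  (\int[mu]_(t in `[a, b]) (x * t `^ (x - 1))%:E = (b `^ x - a `^ x)%:E)%E.
Proof.
move=> a0 ab.
have dP y (t : R) : 0 < t -> {for t, continuous (fun u : R => u `^ y)}.
  move=> t0; apply: differentiable_continuous; apply/derivable1_diffP.
  by apply: derivable_powR; rewrite in_itv/= t0.
have pos (t : R) : a <= t -> 0 < t by exact: lt_le_trans.
have cf t : 0 < t -> {for t, continuous (fun t : R => x * t `^ (x - 1))}.
  by move=> t0; apply: cvgM; [exact: cvg_cst|exact: dP].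
rewrite (@continuous_FTC2 _ _ (fun t => t `^ x)) ?EFinB//.
- apply: continuous_in_subspaceT => t /[!inE]/=.
  by rewrite in_itv/= => /andP[/pos t0 _]; exact: cf.
- split.
  + move=> t; rewrite in_itv/= => /andP[/ltW/pos t0 _].
    by apply: derivable_powR; rewrite in_itv/= t0.
  + by apply: cvg_at_right_filter; exact: dP.
  + by apply: cvg_at_left_filter; apply: dP; apply: pos; exact: ltW.
- move=> t; rewrite in_itv/= => /andP[/ltW/pos t0 _].
  by rewrite powR_derive1// in_itv/= t0.
Qed.

Lemma measurable_scaled_powR {R : realType} (x : R) D :
  measurable_fun D (fun t : R => x * t `^ (x - 1)).
Proof.
by apply: measurable_funTS; apply: measurable_funM => //; exact: measurable_powR.
Qed.

(** For [x < 1] the integrand is unbounded near 0, so the fundamental theorem of calculus is used on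
    [[e k, s]] only, and monotone convergence carries it to the limit as [e k] decreases to 0. *)
Lemma integral_powR_itv0 {R : realType} (x s : R) : 0 < x -> 0 < s ->
  (\int[mu]_(t in `]0%R, s]) (x * t `^ (x - 1))%:E = (s `^ x)%:E)%E.
Proof.
move=> x0 s0.
(* [k.+2] makes [e k < s] strict already at [k = 0]. *)
pose e k : R := s / k.+2%:R.
have e0 k : 0 < e k by rewrite divr_gt0.
have es k : e k < s by rewrite ltr_pdivrMr// ltr_pMr// ltr1n.
have cve : e k @[k --> \oo] --> 0.
  rewrite -(mulr0 s); apply: cvgM; first exact: cvg_cst.
  have := cvg_harmonic (R := R); rewrite -(cvg_shiftn 1%N).
  by under eq_fun do rewrite /= addn1.
have UE : \bigcup_k `[e k, s]%classic = `]0, s]%classic.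
  apply/seteqP; split=> [t [k _]|t] /=; rewrite !in_itv/=.
    by move=> /andP[ket ->]; rewrite (lt_le_trans (e0 k)).
  move=> /andP[t0 ts].
  have /cvgrPdist_lt/(_ _ t0)[k _ /(_ k (leqnn k))] := cve.
  rewrite sub0r normrN gtr0_norm// => ket; exists k => //=.
  by rewrite in_itv/= ts ltW.
rewrite -UE.
have cvI := @ge0_nondecreasing_set_cvg_integral _ (measurableTypeR R) R
  (fun k => `[e k, s]%classic) (fun t => (x * t `^ (x - 1))%:E) mu.
rewrite -(cvg_lim _ (cvI _ _ _ _))//; first apply/cvg_lim => //.
- under eq_fun do rewrite integral_powR_itv//.
  apply: cvg_EFin; first by apply: nearW.
  rewrite -[X in _ --> X]subr0; apply: cvgB; first exact: cvg_cst.
  apply: (@cvg_comp _ _ _ e (fun t : R => t `^ x) _ (0^'+)); last exact: powR_cvg0.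
  move=> A [d /= d0 dA].
  have /cvgrPdist_lt/(_ _ d0)[k _ kd] := cve.
  by exists k => // j /kd/= dj; apply: dA.
- apply/nondecreasing_seqP => k; rewrite subsetEset => t /=; rewrite !in_itv/=.
  move=> /andP[+ ->]; rewrite andbT; apply: le_trans.
  by rewrite /e ler_pM2l// lef_pV2 ?posrE// ler_nat.
- by move=> k; apply/measurable_EFinP; exact: measurable_scaled_powR.
- by move=> k t _; rewrite lee_fin mulr_ge0 ?powR_ge0 ?ltW.
Qed.

(** The Gamma integral with values in the extended reals: the real-valued integral would turn an
    infinite value into 0, so the functional equation and the comparisons are proved here, before
    finiteness is known. *)
Definition Gint {R : realType} (x : R) : \bar R :=
  (\int[mu]_(t in `]0%R, +oo[) (t `^ (x - 1) * expR (- t))%:E)%E.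

Lemma measurable_Gint {R : realType} (x : R) D :
  measurable_fun D (fun t : R => t `^ (x - 1) * expR (- t)).
Proof.
apply: measurable_funTS; apply: measurable_funM; first exact: measurable_powR.
by apply: measurableT_comp => //; exact: measurable_expR.
Qed.

(* Tonelli for [x t^(x-1) e^(-s)] on [0 < t <= s]; the integrand is nonnegative,
   so no integrability is needed and finiteness can be deduced afterwards. *)
Lemma GintD1 {R : realType} (x : R) : 0 < x -> Gint (x + 1) = (x%:E * Gint x)%E.
Proof.
move=> x0.
pose f (p : R * R) : \bar R := (if (0 < p.1) && (p.1 <= p.2)
  then x * p.1 `^ (x - 1) * expR (- p.2) else 0)%:E.
have f0 p : (0 <= f p)%E.
  rewrite /f; case: ifP => _ //; rewrite lee_fin.
  by rewrite mulr_ge0 ?expR_ge0// mulr_ge0 ?powR_ge0// ltW.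
have mf : measurable_fun setT f.
  apply/measurable_EFinP; apply: measurable_fun_ifT => //=.
    by apply: measurable_and; [exact: measurable_fun_ltr|exact: measurable_fun_ler].
  apply: measurable_funM.
    apply: measurable_funM => //.
    exact: (measurableT_comp (measurable_powR _)).
  apply: (@measurableT_comp _ _ _ _ _ _ (@expR R)) => //.
  exact: (@measurableT_comp _ _ _ _ _ _ (@GRing.opp R)).
have := @fubini_tonelli _ _ _ _ _ mu mu f mf f0.
have -> : (\int[mu]_t \int[mu]_s f (t, s) = x%:E * Gint x)%E.
  rewrite /Gint -ge0_integralZl//; last 3 first.
  - by apply/measurable_EFinP; exact: measurable_Gint.
  - by move=> t _; rewrite lee_fin mulr_ge0 ?powR_ge0 ?expR_ge0.
  - by rewrite lee_fin ltW.
  rewrite [RHS]integral_mkcond; apply: eq_integral => t _; rewrite patchE.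
  have [t0|t0] := ltP 0 t; last first.
    rewrite memNset/=; last by rewrite in_itv/= ltNge t0.
    by apply: integral0_eq => s _; rewrite /f/= ltNge t0.
  rewrite mem_set/=; last by rewrite in_itv/= t0.
  rewrite -EFinM mulrA EFinM -integral_expRN_tail -ge0_integralZl//; last 2 first.
  - apply/measurable_EFinP/measurable_funTS.
    exact: (@measurableT_comp _ _ _ _ _ _ (@expR R) _ (@GRing.opp R)).
  - by rewrite lee_fin mulr_ge0 ?powR_ge0 ?ltW.
  rewrite [RHS]integral_mkcond; apply: eq_integral => s _; rewrite patchE /f/= t0/=.
  have [ts|ts] := leP t s; first by rewrite mem_set//= in_itv/= ts.
  by rewrite memNset//= in_itv/= leNgt ts.
move=> ->; rewrite /Gint integral_mkcond; apply: eq_integral => s _; rewrite patchE.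
have [s0|s0] := ltP 0 s; last first.
  rewrite memNset/=; last by rewrite in_itv/= ltNge s0.
  rewrite integral0_eq// => t _; rewrite /f/=; case: ifP => // /andP[t0 ts].
  by have := lt_le_trans t0 (le_trans ts s0); rewrite ltxx.
rewrite mem_set/=; last by rewrite in_itv/= s0.
rewrite addrK EFinM -(@integral_powR_itv0 _ x)// -ge0_integralZr//; last 2 first.
- by apply/measurable_EFinP; exact: measurable_scaled_powR.
- by move=> t _; rewrite lee_fin mulr_ge0 ?powR_ge0 ?ltW.
rewrite integral_mkcond; apply: eq_integral => t _; rewrite patchE /f/=.
have [ts|/negbTE ts] := boolP (0 < t <= s).
  by rewrite mem_set//= in_itv/= ts.
by rewrite memNset//= in_itv/= ts.
Qed.

Lemma Gint_ge0 {R : realType} (x : R) : (0 <= Gint x)%E.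
Proof.
by apply: integral_ge0 => t _; rewrite lee_fin mulr_ge0 ?powR_ge0 ?expR_ge0.
Qed.

Lemma Gint_nat {R : realType} (n : nat) : Gint (n.+1%:R : R) = n`!%:R%:E.
Proof.
elim: n => [|n IH].
  rewrite /Gint subrr.
  under eq_integral do rewrite powRr0 mul1r.
  rewrite integral_itv_obnd_cbnd ?integral_expRN_tail ?oppr0 ?expR0 ?fact0//.
  apply/measurable_EFinP/measurable_funTS.
  exact: (@measurableT_comp _ _ _ _ _ _ (@expR R) _ (@GRing.opp R)).
by rewrite -addn1 natrD GintD1// IH -EFinM factS natrM.
Qed.

(* [t ^ (z - 1) <= t ^ (y - 1) + t ^ y] for [t > 0], comparing [t] with [1] *)
Lemma le_Gint {R : realType} (y z : R) : y <= z <= y + 1 ->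
  (Gint z <= Gint y + Gint (y + 1))%E.
Proof.
move=> /andP[yz zy].
have ge0 u (t : R) : (0 <= (t `^ (u - 1) * expR (- t))%:E)%E.
  by rewrite lee_fin mulr_ge0 ?powR_ge0 ?expR_ge0.
have mG u : measurable_fun (`]0%R, +oo[ : set R) (fun t : R => (t `^ (u - 1) * expR (- t))%:E).
  by apply/measurable_EFinP; exact: measurable_Gint.
rewrite /Gint -ge0_integralD//; [|exact: mG..].
apply: ge0_le_integral => //.
- exact: mG.
- by apply: emeasurable_funD; exact: mG.
move=> t /=; rewrite in_itv/= andbT => t0.
rewrite -EFinD lee_fin -mulrDl ler_wpM2r ?expR_ge0//.
have [t1|/ltW t1] := leP t 1.
  rewrite (@le_trans _ _ (t `^ (y - 1)))// ?lerDl ?powR_ge0//.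
  by rewrite ger_powR ?t0// lerD2r.
rewrite (@le_trans _ _ (t `^ (y + 1 - 1)))// ?lerDr ?powR_ge0//.
by rewrite ler_powR// lerD2r.
Qed.

Lemma nat_between {R : realType} (z : R) : 0 < z ->
  exists n : nat, n%:R <= z <= n%:R + 1.
Proof.
move=> z0; exists (Num.truncn z).
by have /andP[-> /ltW] := truncn_itv (ltW z0); rewrite -addn1 natrD.
Qed.

Lemma Gint_fin {R : realType} (x : R) : 0 < x -> Gint x \is a fin_num.
Proof.
move=> x0.
(* For [x < 1] there is no positive integer below [x] to compare with; [x + 1] always lies between
   two positive integers [n + 1] and [n + 2], where [Gint] is a factorial. *)
suff : (Gint (x + 1) < +oo)%E.
  rewrite GintD1// => lt; rewrite ge0_fin_numE ?Gint_ge0//.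
  by move: lt; case: (Gint x) (Gint_ge0 x) => [r _ _|_|//]; rewrite ?ltry// gt0_muley ?lte_fin.
have [n nx] := nat_between x x0.
apply: (@le_lt_trans _ _ (Gint n.+1%:R + Gint (n.+1%:R + 1)))%E.
  by apply: le_Gint; rewrite -addn1 natrD !lerD2r.
by rewrite -[n.+1%:R + 1](natrD _ _ 1%N) addn1 !Gint_nat ltry.
Qed.

Lemma GammaE {R : realType} (x : R) : 0 < x -> (Gamma x)%:E = Gint x.
Proof. by move=> x0; rewrite /Gamma /Rintegral fineK// Gint_fin. Qed.

Lemma GammaD1 {R : realType} (x : R) : 0 < x -> Gamma (x + 1) = x * Gamma x.
Proof.
move=> x0; apply: EFin_inj; rewrite EFinM !GammaE ?GintD1//.
by rewrite addr_gt0.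
Qed.

(** If [n <= x <= n + 1], then [x <= n + 1 <= x + 1], and the comparison of [le_Gint] gives [n! <=
    Gamma x + Gamma (x + 1) = (1 + x) * Gamma x]. *)
Lemma Gamma_gt0 {R : realType} (x : R) : 0 < x -> 0 < Gamma x.
Proof.
move=> x0; have [n /andP[nx xn]] := nat_between x x0.
have x10 : 0 < x + 1 by rewrite addr_gt0.
have : (Gint (n.+1%:R : R) <= Gint x + Gint (x + 1))%E.
  by apply: le_Gint; rewrite -addn1 natrD xn lerD2r.
rewrite Gint_nat -!GammaE// GammaD1// -EFinD lee_fin => le.
have : 0 < (1 + x) * Gamma x.
  by apply: lt_le_trans (le_trans le _); rewrite ?ltr0n ?fact_gt0// mulrDl mul1r.
by rewrite pmulr_rgt0// addr_gt0.
Qed.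

End GammaFunction.

(** * Single-site duality functions *)

Lemma ffact_mul (n k : nat) : (n * n ^_ k = n ^_ k.+1 + k * n ^_ k)%N.
Proof.
rewrite ffactnSr; have [kn|nk] := leqP k n; last by rewrite ffact_small// !muln0.
by rewrite [(k * _)%N]mulnC -mulnDr subnK// mulnC.
Qed.

Lemma ffactS (n k : nat) : (n.+1 ^_ k = n ^_ k + k * n ^_ k.-1)%N.
Proof. by case: k => [|k] //; rewrite ffactSS mulSn ffact_mul; ring. Qed.

(** For [m > 0] this is the inverse of the rising factorial of [m / 2] of length [k]. *)
Definition dual_coef {R : realType} (m : R) (k : nat) : R :=
  Gamma (m / 2) / Gamma (m / 2 + k%:R).

(** Since [1 / (1 - lam) = 1 + rho lam], both rates become affine in [rho lam], and the boundary
    identities are polynomial. *)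
Lemma death_rateE {R : realType} (lam : R) (n : nat) : lam < 1 ->
  death_rate lam n = n%:R * (1 + rho lam).
Proof.
by move=> lam1; rewrite /death_rate /rho; field; rewrite gt_eqF// subr_gt0.
Qed.

Section DualPolynomials.
Context {R : realType} (m : R).
Hypothesis m_gt0 : 0 < m.

Lemma dual_coef_gt0 k : 0 < dual_coef m k.
Proof. by apply: divr_gt0; apply: Gamma_gt0; rewrite ?ltr_wpDr// divr_gt0. Qed.

Lemma dual_coef0 : dual_coef m 0 = 1.
Proof. by rewrite /dual_coef addr0 divff// gt_eqF// Gamma_gt0// divr_gt0. Qed.

Lemma dual_coefS k : dual_coef m k = (m / 2 + k%:R) * dual_coef m k.+1.
Proof.
have a0 : 0 < m / 2 + k%:R by rewrite ltr_wpDr// divr_gt0.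
rewrite /dual_coef -[k.+1]addn1 natrD addrA GammaD1//.
have := Gamma_gt0 _ a0; move: (Gamma (m / 2 + k%:R)) (Gamma (m / 2)) => g h g0.
by field; rewrite !gt_eqF//; lra.
Qed.

(** The falling factorial vanishes for [k > n], which absorbs the case distinction in [dualD]. *)
Lemma dualD_ffact k n : dualD m k n = (n ^_ k)%:R * dual_coef m k.
Proof.
rewrite /dualD; case: leqP => [kn|nk]; last by rewrite ffact_small// mul0r.
rewrite -(ffact_fact kn) natrM mulfK// pnatr_eq0 -lt0n fact_gt0.
Qed.

(* The three intertwining relations between the su(1,1) ladder operators
   acting on the particle number n and those acting on the dual number k. *)
Lemma dualD_lower k n :
  n%:R * dualD m k n.-1 = (m / 2 + k%:R) * dualD m k.+1 n.
Proof.
by rewrite !dualD_ffact (dual_coefS k) mulrA -natrM -ffactnS mulrCA.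
Qed.

Lemma dualD_diag k n :
  n%:R * dualD m k n = (m / 2 + k%:R) * dualD m k.+1 n + k%:R * dualD m k n.
Proof.
rewrite -dualD_lower !dualD_ffact mulrA -natrM ffact_mul natrD natrM.
by rewrite ffactnS natrM; ring.
Qed.

Lemma dualD_raise k n :
  (m / 2 + n%:R) * dualD m k n.+1 =
  k%:R * dualD m k.-1 n + (m / 2 + k%:R *+ 2) * dualD m k n +
  (m / 2 + k%:R) * dualD m k.+1 n.
Proof.
(* Trading the shift [k + 1] for multiplication by [n] leaves only the indices [k] and [k - 1]. *)
have -> : (m / 2 + k%:R) * dualD m k.+1 n = n%:R * dualD m k n - k%:R * dualD m k n.
  by rewrite dualD_diag addrK.
rewrite !dualD_ffact ffactS natrD natrM.
case: k => [|k]; first by ring.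
have := congr1 (fun i : nat => i%:R : R) (ffact_mul n k).
rewrite /= (dual_coefS k) natrM natrD natrM => e.
have -> : (n ^_ k.+1)%:R = n%:R * (n ^_ k)%:R - k%:R * (n ^_ k)%:R :> R.
  by rewrite e addrK.
by rewrite /=; ring.
Qed.

(** After the ladder relations are inserted, the products of type [D(k+1) D(l+1)], [D(k+1) D(l)] and
    [D(k) D(l+1)] cancel; what survives is one dual particle jumping either way, together with the
    loss term. *)
Lemma dualD_bond k l n1 n2 :
  2 * n1%:R * (m + 2 * n2%:R) *
    (dualD m k n1.-1 * dualD m l n2.+1 - dualD m k n1 * dualD m l n2) +
  2 * n2%:R * (m + 2 * n1%:R) *
    (dualD m k n1.+1 * dualD m l n2.-1 - dualD m k n1 * dualD m l n2) =
  2 * k%:R * (m + 2 * l%:R) *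
    (dualD m k.-1 n1 * dualD m l.+1 n2 - dualD m k n1 * dualD m l n2) +
  2 * l%:R * (m + 2 * k%:R) *
    (dualD m k.+1 n1 * dualD m l.-1 n2 - dualD m k n1 * dualD m l n2).
Proof.
(* Regroups the left side so that [n1] and [n2] occur only in products covered by the ladder
   relations. *)
have E (n1' n2' D1 D1m D1p D2 D2m D2p : R) :
  2 * n1' * (m + 2 * n2') * (D1m * D2p - D1 * D2) +
  2 * n2' * (m + 2 * n1') * (D1p * D2m - D1 * D2) =
  4 * ((n1' * D1m) * ((m / 2 + n2') * D2p) - (n1' * D1) * (m / 2 * D2 + n2' * D2)
    + (n2' * D2m) * ((m / 2 + n1') * D1p) - (n2' * D2) * (m / 2 * D1 + n1' * D1)).
  by field.
move: (dualD_lower k n1) (dualD_diag k n1) (dualD_raise k n1).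
move: (dualD_lower l n2) (dualD_diag l n2) (dualD_raise l n2).
move: (dualD m k n1) (dualD m k n1.-1) (dualD m k n1.+1).
move: (dualD m k.-1 n1) (dualD m k.+1 n1).
move: (dualD m l n2) (dualD m l.-1 n2) (dualD m l.+1 n2).
move: (dualD m l n2.-1) (dualD m l n2.+1).
move=> ? ? ? ? ? ? ? ? ? ? l2 d2 r2 l1 d1 r1.
by rewrite E l1 l2 r1 r2 d1 d2; field.
Qed.

Lemma dualD_boundary (lam : R) k n : lam < 1 ->
  birth_rate m lam n * (dualD m k n.+1 - dualD m k n) +
  death_rate lam n * (dualD m k n.-1 - dualD m k n) =
  k%:R * (dualD m k.-1 n * rho lam - dualD m k n).
Proof.
move=> lam1.
rewrite death_rateE// /birth_rate -/(rho lam).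
(* Within each of the groups [rho lam] and [1 + rho lam] the terms in [D(k+1, n)] cancel
   separately. *)
transitivity (rho lam * ((m / 2 + n%:R) * dualD m k n.+1 - m / 2 * dualD m k n
     - n%:R * dualD m k n) +
   (1 + rho lam) * (n%:R * dualD m k n.-1 - n%:R * dualD m k n)).
  by ring.
rewrite dualD_lower dualD_raise (dualD_diag k n).
by move: (dualD m k n) (dualD m k.-1 n) (dualD m k.+1 n) => *; ring.
Qed.

End DualPolynomials.

(** * Duality on the chain *)

#[local] Opaque dualD.

Lemma jump_src (S : finType) (e : config S) (x y : S) : x != y ->
  jump e x y x = (e x).-1.
Proof. by move=> /negbTE xy; rewrite ffunE eqxx xy addn0 subn1. Qed.

Lemma jump_dst (S : finType) (e : config S) (x y : S) : x != y ->
  jump e x y y = (e y).+1.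
Proof. by rewrite eq_sym => /negbTE xy; rewrite ffunE eqxx xy subn0 addn1. Qed.

Lemma jump_off (S : finType) (e : config S) (x y z : S) :
  z != x -> z != y -> jump e x y z = e z.
Proof. by move=> /negbTE zx /negbTE zy; rewrite ffunE zx zy subn0 addn0. Qed.

Lemma remove_at (S : finType) (e : config S) (x : S) : remove e x x = (e x).-1.
Proof. by rewrite ffunE eqxx subn1. Qed.

Lemma remove_off (S : finType) (e : config S) (x z : S) :
  z != x -> remove e x z = e z.
Proof. by move=> /negbTE zx; rewrite ffunE zx subn0. Qed.

Lemma add_at (S : finType) (e : config S) (x : S) : Defs.add e x x = (e x).+1.
Proof. by rewrite ffunE eqxx addn1. Qed.

Lemma add_off (S : finType) (e : config S) (x z : S) :
  z != x -> Defs.add e x z = e z.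
Proof. by move=> /negbTE zx; rewrite ffunE zx addn0. Qed.

Lemma bulk_site_inj (n : nat) : injective (@bulk_site n).
Proof. by move=> x y /(congr1 val) [] /val_inj. Qed.

Lemma bulk_site_neq0 (n : nat) (x : 'I_n.+1) : bulk_site x != ord0.
Proof. by []. Qed.

Lemma bulk_site_neq_max (n : nat) (x : 'I_n.+1) : bulk_site x != ord_max.
Proof. by rewrite -val_eqE /= eqSS neq_ltn ltn_ord. Qed.

Lemma prod_off1 {R : comNzRingType} (I : finType) (F G : I -> R) (x : I) :
  (forall z, z != x -> G z = F z) ->
  \prod_z G z = (\prod_(z | z != x) F z) * G x.
Proof. by move=> GF; rewrite (bigD1 x)//= mulrC (eq_bigr _ GF). Qed.

Lemma prod_off2 {R : comNzRingType} (I : finType) (F G : I -> R) (x y : I) :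
  x != y -> (forall z, z != x -> z != y -> G z = F z) ->
  \prod_z G z = (\prod_(z | (z != x) && (z != y)) F z) * (G x * G y).
Proof.
move=> xy GF; rewrite (bigD1 x)//= (bigD1 y)/=; last by rewrite eq_sym.
rewrite mulrA mulrC; congr (_ * _).
by apply: eq_bigr => z /andP[]; exact: GF.
Qed.

Section DualityFunction.
Context {R : realType} (m : R) (lam : side -> R) (n : nat).
Implicit Types (xi : config 'I_n.+3) (eta : config 'I_n.+1) (x y : 'I_n.+1).

(** Contains the reservoir factors, because a jump across a bond leaves both end coordinates of [xi]
    unchanged; [dual_weight_off1] omits them, because absorption changes one of them. *)
Definition dual_weight_off2 xi eta x y : R :=
  rho (lam Lft) ^+ xi ord0 * rho (lam Rgt) ^+ xi ord_max *
  \prod_(z < n.+1 | (z != x) && (z != y)) dualD m (xi (bulk_site z)) (eta z).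

Lemma dualFun_off2 xi xi' eta eta' x y : x != y ->
  (forall z, z != bulk_site x -> z != bulk_site y -> xi' z = xi z) ->
  (forall z, z != x -> z != y -> eta' z = eta z) ->
  dualFun m lam xi' eta' = dual_weight_off2 xi eta x y *
    (dualD m (xi' (bulk_site x)) (eta' x) *
     dualD m (xi' (bulk_site y)) (eta' y)).
Proof.
move=> xy hxi heta; rewrite /dualFun /dual_weight_off2.
have -> : xi' ord0 = xi ord0 by apply: hxi; rewrite eq_sym bulk_site_neq0.
have -> : xi' ord_max = xi ord_max.
  by apply: hxi; rewrite eq_sym bulk_site_neq_max.
rewrite (@prod_off2 _ _ (fun z => dualD m (xi (bulk_site z)) (eta z))
  (fun z => dualD m (xi' (bulk_site z)) (eta' z)) _ _ xy).
  by rewrite mulrAC !mulrA.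
by move=> z zx zy; rewrite hxi ?heta// (inj_eq (@bulk_site_inj n)).
Qed.

Definition dual_weight_off1 xi eta x : R :=
  \prod_(z < n.+1 | z != x) dualD m (xi (bulk_site z)) (eta z).

Lemma dualFun_off1 xi xi' eta eta' x :
  (forall z, z != x -> xi' (bulk_site z) = xi (bulk_site z)) ->
  (forall z, z != x -> eta' z = eta z) ->
  dualFun m lam xi' eta' = dual_weight_off1 xi eta x *
    (rho (lam Lft) ^+ xi' ord0 * dualD m (xi' (bulk_site x)) (eta' x) *
     rho (lam Rgt) ^+ xi' ord_max).
Proof.
move=> hxi heta; rewrite /dualFun /dual_weight_off1.
rewrite (@prod_off1 _ _ (fun z => dualD m (xi (bulk_site z)) (eta z))
  (fun z => dualD m (xi' (bulk_site z)) (eta' z)) x).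
  by ring.
by move=> z zx; rewrite hxi ?heta.
Qed.

Hypothesis m_gt0 : 0 < m.

Lemma bond_duality xi eta x y : x != y ->
  let f := @dualFun R m lam n in
  let bx := bulk_site x in
  let by_ := bulk_site y in
  2 * (eta x)%:R * (m + 2 * (eta y)%:R) * (f xi (jump eta x y) - f xi eta) +
  2 * (eta y)%:R * (m + 2 * (eta x)%:R) * (f xi (jump eta y x) - f xi eta) =
  2 * (xi bx)%:R * (m + 2 * (xi by_)%:R) * (f (jump xi bx by_) eta - f xi eta) +
  2 * (xi by_)%:R * (m + 2 * (xi bx)%:R) * (f (jump xi by_ bx) eta - f xi eta).
Proof.
move=> xy f bx by_; rewrite {}/f.
have yx : y != x by rewrite eq_sym.
have bxy : bx != by_ by rewrite (inj_eq (@bulk_site_inj n)).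
have byx : by_ != bx by rewrite eq_sym.
have E xi' eta' := @dualFun_off2 xi xi' eta eta' x y xy.
have -> : dualFun m lam xi (jump eta x y) = dual_weight_off2 xi eta x y *
    (dualD m (xi bx) (eta x).-1 * dualD m (xi by_) (eta y).+1).
  rewrite -(jump_src _ eta _ _ xy) -(jump_dst _ eta _ _ xy).
  by apply: E => // z zx zy; exact: jump_off.
have -> : dualFun m lam xi (jump eta y x) = dual_weight_off2 xi eta x y *
    (dualD m (xi bx) (eta x).+1 * dualD m (xi by_) (eta y).-1).
  rewrite -(jump_src _ eta _ _ yx) -(jump_dst _ eta _ _ yx).
  by apply: E => // z zx zy; exact: jump_off.
have -> : dualFun m lam (jump xi bx by_) eta = dual_weight_off2 xi eta x y *
    (dualD m (xi bx).-1 (eta x) * dualD m (xi by_).+1 (eta y)).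
  rewrite -(jump_src _ xi _ _ bxy) -(jump_dst _ xi _ _ bxy).
  by apply: E => // z zx zy; exact: jump_off.
have -> : dualFun m lam (jump xi by_ bx) eta = dual_weight_off2 xi eta x y *
    (dualD m (xi bx).+1 (eta x) * dualD m (xi by_).-1 (eta y)).
  rewrite -(jump_src _ xi _ _ byx) -(jump_dst _ xi _ _ byx).
  by apply: E => // z zx zy; exact: jump_off.
have -> : dualFun m lam xi eta = dual_weight_off2 xi eta x y *
    (dualD m (xi bx) (eta x) * dualD m (xi by_) (eta y)) by exact: E.
rewrite -!mulrBr !(mulrCA _ (dual_weight_off2 xi eta x y)) -!mulrDr.
by congr (_ * _); exact: dualD_bond.
Qed.

Lemma Lbulk_duality xi eta :
  Lbulk m id (dualFun m lam xi) eta =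
  Lbulk m (@bulk_site n) (fun xi' => dualFun m lam xi' eta) xi.
Proof.
apply: eq_bigr => i _; apply: bond_duality.
by rewrite -val_eqE /= neq_ltn /bump /= add1n ltnSn.
Qed.

(** The single-site identity [dualD_boundary] suffices: the rest of the product is a common factor,
    and a particle absorbed at [s] contributes one more factor [rho (lam a)]. Taking the side as a
    parameter treats both reservoirs at once. *)
Lemma Lbirthdeath_duality (a : side) (s : 'I_n.+3) xi eta x :
    lam a < 1 -> s = (if a is Lft then ord0 else ord_max) ->
  Lbirthdeath (birth_rate m (lam a)) (death_rate (lam a)) x
    (dualFun m lam xi) eta =
  Labsorb (bulk_site x) s (fun xi' => dualFun m lam xi' eta) xi.
Proof.
move=> lam1 sE; rewrite /Lbirthdeath /Labsorb.
have sb z : bulk_site z != s.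
  by rewrite sE; case: (a); [exact: bulk_site_neq0|exact: bulk_site_neq_max].
have E xi' eta' := @dualFun_off1 xi xi' eta eta' x.
set W := dual_weight_off1 xi eta x in E.
have -> : dualFun m lam xi (remove eta x) = W * (rho (lam Lft) ^+ xi ord0 *
    dualD m (xi (bulk_site x)) (eta x).-1 * rho (lam Rgt) ^+ xi ord_max).
  by rewrite -remove_at; apply: E => // z zx; exact: remove_off.
have -> : dualFun m lam xi (Defs.add eta x) = W * (rho (lam Lft) ^+ xi ord0 *
    dualD m (xi (bulk_site x)) (eta x).+1 * rho (lam Rgt) ^+ xi ord_max).
  by rewrite -add_at; apply: E => // z zx; exact: add_off.
have -> : dualFun m lam (jump xi (bulk_site x) s) eta =
    W * (rho (lam Lft) ^+ xi ord0 * (rho (lam a) *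
    dualD m (xi (bulk_site x)).-1 (eta x)) * rho (lam Rgt) ^+ xi ord_max).
  rewrite E//; last first.
    by move=> z zx; rewrite jump_off// (inj_eq (@bulk_site_inj n)).
  rewrite (jump_src _ xi _ _ (sb x)).
  case: a sE {lam1} => sE; rewrite {}sE in sb *.
    rewrite (jump_dst _ xi _ _ (sb x)) jump_off ?(eq_sym ord_max) ?bulk_site_neq_max//.
    by rewrite exprS; ring.
  rewrite (jump_dst _ xi _ _ (sb x)) jump_off ?(eq_sym ord0) ?bulk_site_neq0//.
  by rewrite exprS; ring.
rewrite (E xi eta)//.
have := dualD_boundary m m_gt0 (lam a) (xi (bulk_site x)) (eta x) lam1.
move: (dualD m (xi (bulk_site x)) (eta x)) (dualD m (xi (bulk_site x)).-1 (eta x)).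
move: (dualD m (xi (bulk_site x)) (eta x).-1) (dualD m (xi (bulk_site x)) (eta x).+1).
move: (birth_rate _ _ _) (death_rate _ _) (rho (lam a)).
move: (rho (lam Lft) ^+ _) (rho (lam Rgt) ^+ _) => u v p q r D1 D2 D3 D4 e.
transitivity (W * u * v * (p * (D2 - D3) + q * (D1 - D3))); first by ring.
by rewrite e; ring.
Qed.

End DualityFunction.

(** * Uniqueness of the boundary rates *)

Section BoundaryRates.
Context {R : realType} (m lam : R).
Hypothesis m_gt0 : 0 < m.

(** By the functional equation of Gamma, [nu m lam k.+1] is [nu m lam k] times
    [lam (m / 2 + k) / (k + 1)]. *)
Lemma detailed_balance_rates : lam < 1 ->
  detailed_balance m lam (birth_rate m lam) (death_rate lam).
Proof.
move=> lam1 k; rewrite /birth_rate /death_rate /nu.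
have a0 : 0 < m / 2 by rewrite divr_gt0.
have ak0 : 0 < m / 2 + k%:R by rewrite ltr_wpDr.
have -> : m / 2 + k.+1%:R = m / 2 + k%:R + 1 by rewrite -[k.+1%:R]natr1 addrA.
rewrite GammaD1// factS natrM exprS.
have := Gamma_gt0 _ a0; have : 0 < k`!%:R :> R by rewrite ltr0n fact_gt0.
move: (Gamma (m / 2)) (Gamma (m / 2 + k%:R)) (_ `^ _) (k`!%:R) => g h p f f0 g0.
by field; rewrite !gt_eqF ?subr_gt0 ?ltr_wpDr.
Qed.

(** Allows division by the weights in the converse; at [lam = 0] they vanish for [k >= 1]. *)
Lemma nu_gt0 k : 0 < lam -> lam < 1 -> 0 < nu m lam k.
Proof.
move=> lam0 lam1; have a0 : 0 < m / 2 by rewrite divr_gt0.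
rewrite /nu !mulr_gt0 ?powR_gt0 ?subr_gt0 ?exprn_gt0 ?invr_gt0 ?ltr0n ?fact_gt0//.
  by apply: Gamma_gt0; rewrite ltr_wpDr.
exact: Gamma_gt0.
Qed.

(** The relation with [k = 1]: [D(1, n)] is linear in [n], so its increments are constant. *)
Lemma boundary_duality1 {b d : nat -> R} {n : nat} :
  boundary_duality m lam b d -> (0 < n)%N ->
  b n - d n = m / 2 * rho lam - n%:R.
Proof.
case: n => // n bd _; have := bd 1%N n.+1 isT.
rewrite !dualD_ffact// !ffactn1 !ffactn0 dual_coef0//=.
have := dual_coef_gt0 m m_gt0 1.
have := dual_coefS m m_gt0 0; rewrite dual_coef0// addr0.
move: (dual_coef m 1) (b n.+1) (d n.+1) (rho lam) => c B D r c1 c0 e.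
apply: (@mulIf _ c); first by rewrite gt_eqF.
transitivity (B * (n.+2%:R * c - n.+1%:R * c) + D * (n%:R * c - n.+1%:R * c)).
  by ring.
transitivity (r * (m / 2 * c) - n.+1%:R * c); last by ring.
by rewrite e -c1; ring.
Qed.

(** The relation with [k = 2], where [D(2, n)] is proportional to [n (n - 1)]; the common factor to
    cancel is [2 * dual_coef m 2]. *)
Lemma boundary_duality2 {b d : nat -> R} {n : nat} :
  boundary_duality m lam b d -> (1 < n)%N ->
  n%:R * b n - (n%:R - 1) * d n =
  n%:R * ((m / 2 + 1) * rho lam - (n%:R - 1)).
Proof.
case: n => [|[|n]]// bd _; have := bd 2%N n.+2 isT.
rewrite !dualD_ffact// (dual_coefS m m_gt0 1)/= ffactn1 !(ffactSS _ 1) !ffactn1.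
rewrite !natrM.
have := dual_coef_gt0 m m_gt0 2.
move: (dual_coef m 2) (b n.+2) (d n.+2) (rho lam) => c B D r c0 e.
apply: (@mulIf _ (2 * c)); first by rewrite mulf_neq0// gt_eqF.
transitivity (B * (n.+3%:R * n.+2%:R * c - n.+2%:R * n.+1%:R * c) +
    D * (n.+1%:R * n%:R * c - n.+2%:R * n.+1%:R * c)).
  by ring.
by rewrite e; ring.
Qed.

Lemma detailed_balance_unique (b d b' d' : nat -> R) (k : nat) :
  0 < lam -> lam < 1 -> detailed_balance m lam b d ->
  detailed_balance m lam b' d' -> d k.+1 = d' k.+1 -> b k = b' k.
Proof.
move=> lam0 lam1 db db' dd'; apply: (@mulIf _ (nu m lam k)).
  by rewrite gt_eqF// nu_gt0.
by rewrite db db' dd'.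
Qed.

Lemma boundary_rates_unique (b d : nat -> R) :
  0 < lam -> lam < 1 -> d 0%N = 0 ->
  detailed_balance m lam b d -> boundary_duality m lam b d ->
  forall n, b n = birth_rate m lam n /\ d n = death_rate lam n.
Proof.
move=> lam0 lam1 d0 db bd.
have db' := detailed_balance_rates lam1.
have bE k := @detailed_balance_unique _ _ _ _ k lam0 lam1 db db'.
have dE n : (0 < n)%N -> b n = birth_rate m lam n -> d n = death_rate lam n.
  move=> n0 bn; have := boundary_duality1 bd n0.
  rewrite bn death_rateE// /birth_rate -/(rho lam) => e.
  by apply: oppr_inj; apply: (addrI ((m / 2 + n%:R) * rho lam)); rewrite e; ring.
have b2 n : (1 < n)%N -> b n = birth_rate m lam n.
  move=> n1; have e1 := boundary_duality1 bd (ltnW n1).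
  have e2 := boundary_duality2 bd n1; rewrite /birth_rate -/(rho lam).
  (* Subtracting [n - 1] times the first relation from the second eliminates [d n] and leaves [b n]
     with coefficient 1. *)
  transitivity (n%:R * b n - (n%:R - 1) * d n - (n%:R - 1) * (b n - d n)).
    by ring.
  by rewrite e1 e2; ring.
have b1 : b 1%N = birth_rate m lam 1 by apply: bE; apply: dE => //; exact: b2.
have b0 : b 0%N = birth_rate m lam 0 by apply: bE; exact: dE.
case=> [|[|n]]; split=> //.
(* Detailed balance involves only [d k.+1], and at [n = 0] the boundary relation is trivial, so
   [d 0] comes from the convention. *)
- by rewrite d0 /death_rate mul0r.
- exact: dE.
- exact: b2.
- by apply: dE => //; exact: b2.
Qed.

End BoundaryRates.

Theorem mainTheorem9 (R : realType) (m : R) (hm : 0 < m) (lam : side -> R)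
    (hlam : forall a : side, 0 <= lam a /\ lam a < 1) :
  ((forall a : side,
      detailed_balance m (lam a) (birth_rate m (lam a)) (death_rate (lam a))) /\
   (forall (n : nat) (xi : config 'I_n.+3) (eta : config 'I_n.+1),
      Lsip m (fun a => birth_rate m (lam a)) (fun a => death_rate (lam a))
        (fun eta' => dualFun m lam xi eta') eta =
      Ldual m (fun xi' => dualFun m lam xi' eta) xi)) /\
  ((forall a : side, 0 < lam a) ->
   forall b d : side -> nat -> R,
     (forall a : side, d a 0%N = 0) ->
     (forall a : side, detailed_balance m (lam a) (b a) (d a)) ->
     (forall a : side, boundary_duality m (lam a) (b a) (d a)) ->
     forall (a : side) (n : nat),
       b a n = birth_rate m (lam a) n /\ d a n = death_rate (lam a) n).
Proof.
have lam1 a : lam a < 1 by have [] := hlam a.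
split; first split.
- by move=> a; exact: detailed_balance_rates.
- move=> n xi eta; rewrite /Lsip /Ldual addrC addrA.
  rewrite (Lbulk_duality m lam n hm xi eta).
  rewrite (Lbirthdeath_duality m lam n hm Lft ord0)//.
  by rewrite (Lbirthdeath_duality m lam n hm Rgt ord_max).
- move=> lam0 b d d0 db bd a; exact: boundary_rates_unique.
Qed.
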